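(* Let $G$ be a group generated by a finite symmetric set $S$ and let $H$ be any subgroup of $G$. Put $$I(H,S)=\limsup_{n\to\infty}\int_G |H^g\cap S|\,\bigl(-\log\rho(H^g,S\cap H^g)\bigr)\,d\mu_{2n}(g).$$ Then $$\log \rho(H\backslash G,S)-\log\rho(G,S)\ \geq\ \frac{I(H,S)}{|S|^2\rho(G,S)^2}.$$
   Context: For $g\in G$, $H^g=g^{-1}Hg$. For a group $K$ with a finite symmetric generating set $F$, $\rho(K,F)$ is the spectral radius of the Cayley graph, i.e. the operator norm on $\ell^2(K)$ of $f\mapsto\big(x\mapsto\frac1{|F|}\sum_{s\in F}f(xs)\big)$. If $F\subset K$ is a finite symmetric subset that does not generate $K$, then by convention $\rho(K,F)=\rho(\langle F\rangle,F)$. If $S\cap H^g=\emptyset$, the integrand $|H^g\cap S|(-\log\rho(H^g,S\cap H^g))$ is taken to be $0$. $\rho(H\backslash G,S)$ is the spectral radius of the Schreier graph on $H\backslash G=\{Hg:g\in G\}$, i.e. the operator norm on $\ell^2(H\backslash G)$ of $f\mapsto\big(Hg\mapsto\frac1{|S|}\sum_{s\in S}f(Hgs)\big)$. A walk of length $n$ is a sequence $w=(a_1,\dots,a_n)\in S^n$, and $w(i)=a_1a_2\cdots a_i$ is its position after $i$ steps. $A(n,S)$ is the set of walks $w\in S^n$ with $w(n)=e$. For $n$ with $A(n,S)\ne\emptyset$ (in particular for all even $n\ge 2$), $\mu_n$ is the probability measure on $G$ $$\mu_n=\frac{1}{|A(n,S)|}\sum_{w\in A(n,S)}\Bigl(\frac1n\sum_{i=1}^n\delta_{w(i)}\Bigr).$$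 *)

(* Defs.v *)
From HB Require Import structures.
From mathcomp Require Import all_boot all_order all_algebra finmap.
From mathcomp Require Import all_classical all_reals all_analysis.

Set Implicit Arguments.
Unset Strict Implicit.
Unset Printing Implicit Defensive.
Import Order.TTheory GRing.Theory Num.Theory.

Local Open Scope classical_set_scope.
Local Open Scope ring_scope.

Section OperatorNorm.
Context {R : realType} {T : choiceType}.

(* The l^2 spaces are spaces of real-valued functions; the operators below have
   real coefficients, so their norm is the same on complex l^2. An element of
   l^2(X) is given by any of its extensions to the ambient type T: [l2norm X f]
   reads f on X only, and it is +oo when the restriction is not in l^2(X). *)
Definition l2norm (X : set T) (f : T -> R) : \bar R :=
  ((\esum_(x in X) ((f x) ^+ 2)%:E) `^ 2^-1)%E.

(* Meaningful for operators M such that M f on X depends only on f on X, and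
   that are bounded on l^2(X); [fine] would send an infinite norm to 0. *)
Definition opnorm (X : set T) (M : (T -> R) -> (T -> R)) : R :=
  fine (ereal_sup [set l2norm X (M f) | f in [set f | (l2norm X f <= 1)%E]]).

End OperatorNorm.

Section Groups.
Context {G : groupType}.
Implicit Types (H K A : set G) (F : {fset G}).

Definition subgroup H : Prop := group_closed (mem H).

Definition gen A : set G := smallest subgroup A.

Definition conj_set H (g : G) : set G := [set (h ^ g)%g | h in H].

Definition rtranslate A (g : G) : set G := [set (a * g)%g | a in A].

Definition right_cosets H : set (set G) := range (rtranslate H).

Definition fset_inter F A : {fset G} := [fset s in F | s \in A]%fset.

End Groups.

Section SpectralRadii.
Context (R : realType) {G : groupType}.
Implicit Types (H K : set G) (F S : {fset G}).

Definition cayley_op F (f : G -> R) (x : G) : R :=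
  #|` F|%:R^-1 * \sum_(s <- F) f (x * s)%g.

(* Used when F generates K. *)
Definition rho_cayley K F : R := opnorm K (cayley_op F).

(* (Hg)s = H(gs), so right translation of cosets is the action on H\G. *)
Definition schreier_op S (f : set G -> R) (C : set G) : R :=
  #|` S|%:R^-1 * \sum_(s <- S) f (rtranslate C s).

Definition rho_schreier H S : R := opnorm (right_cosets H) (schreier_op S).

(* rho(H^g, S `&` H^g) is by convention computed in the subgroup generated by
   S `&` H^g; if S `&` H^g is empty, the first factor makes the value 0. *)
Definition integrand H S (g : G) : R :=
  let F := fset_inter S (conj_set H g) in
  #|` F|%:R * - ln (rho_cayley (gen [set` F]) F).

End SpectralRadii.

(* A copy of the group with the discrete sigma-algebra. *)
Definition discrete_group (G : groupType) : Type := G.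

Section DiscreteGroup.
Variable G : groupType.

HB.instance Definition _ := Choice.on (discrete_group G).
HB.instance Definition _ := isPointed.Build (discrete_group G) (1%g : G).
HB.instance Definition _ := @isMeasurable.Build default_measure_display
  (discrete_group G) discrete_measurable discrete_measurable0
  discrete_measurableC discrete_measurableU.

End DiscreteGroup.

Section Walks.
Context {G : groupType} (S : {fset G}) (n : nat).

Definition walk_pos (w : n.-tuple S) (i : nat) : G :=
  \big[*%g/1%g]_(a <- take i w) fsval a.

Definition closed_walk : pred (n.-tuple S) := [pred w | walk_pos w n == 1%g].

End Walks.

Lemma sum_semi_sigma_additive d (T : measurableType d) (R : realType)
    (I : Type) (s : seq I) (P : pred I) (m : I -> {measure set T -> \bar R}) :
  semi_sigma_additive (fun B => \sum_(i <- s | P i) m i B)%E.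
Proof.
have [[x0]|noI] := pselect (inhabited I); last first.
  have -> : s = [::] by case: s => // x; case: noI.
  rewrite (_ : (fun _ => _) = @mzero _ T R); last first.
    by apply/funext => B; rewrite big_nil.
  exact: measure_semi_sigma_additive.
set r := [seq i <- s | P i].
rewrite (_ : (fun _ => _) = msum (fun k => m (nth x0 r k)) (size r)).
  exact: measure_semi_sigma_additive.
by apply/funext => B; rewrite -big_filter (big_nth x0) big_mkord.
Qed.

Section OccupationMeasure.
Context (R : realType) {G : groupType} {S : {fset G}} {n : nat}.
Variable w : n.-tuple S.
Local Notation T := (discrete_group G).
Local Open Scope ereal_scope.

Let visits (B : set T) : \bar R :=
  \sum_(1 <= i < n.+1) \d_(walk_pos w i : T) B.

Let visits0 : visits set0 = 0. Proof. by rewrite /visits big1. Qed.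

Let visits_ge0 B : 0 <= visits B. Proof. exact: sume_ge0. Qed.

HB.instance Definition _ := isMeasure.Build _ _ _ visits visits0 visits_ge0
  (@sum_semi_sigma_additive _ _ _ _ _ xpredT (fun i => \d_(walk_pos w i : T))).

Definition occupation (B : set T) : \bar R :=
  (n%:R^-1)%:E * \sum_(1 <= i < n.+1) \d_(walk_pos w i : T) B.

Let occupation0 : occupation set0 = 0.
Proof. by rewrite /occupation big1 ?mule0. Qed.

Let occupation_ge0 B : 0 <= occupation B.
Proof. by rewrite mule_ge0// ?lee_fin// sume_ge0. Qed.

Let occupation_sigma_additive : semi_sigma_additive occupation.
Proof.
have r0 : (0 <= n%:R^-1 :> R)%R by rewrite invr_ge0.
exact: (@measure_semi_sigma_additive _ _ _ (mscale (NngNum r0) visits)).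
Qed.

HB.instance Definition _ := isMeasure.Build _ _ _ occupation
  occupation0 occupation_ge0 occupation_sigma_additive.

End OccupationMeasure.

Section WalkMeasure.
Context (R : realType) {G : groupType} (S : {fset G}) (n : nat).
Local Notation T := (discrete_group G).
Local Notation A := (@closed_walk G S n).
Local Open Scope ereal_scope.

Let total (B : set T) : \bar R := \sum_(w | A w) occupation R w B.

Let total0 : total set0 = 0.
Proof. by rewrite /total big1// => w _; rewrite measure0. Qed.

Let total_ge0 B : 0 <= total B. Proof. exact: sume_ge0. Qed.

HB.instance Definition _ := isMeasure.Build _ _ _ total total0 total_ge0
  (@sum_semi_sigma_additive _ _ _ _ _ A (occupation R)).

(* The zero measure when there is no closed walk of length n. *)
Definition mu (B : set T) : \bar R :=
  (#|A|%:R^-1)%:E * \sum_(w | A w) occupation R w B.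

Let mu0 : mu set0 = 0.
Proof. by rewrite /mu [X in _ * X]total0 mule0. Qed.

Let mu_ge0 B : 0 <= mu B.
Proof. by rewrite mule_ge0// ?lee_fin// sume_ge0. Qed.

Let mu_sigma_additive : semi_sigma_additive mu.
Proof.
have r0 : (0 <= #|A|%:R^-1 :> R)%R by rewrite invr_ge0.
exact: (@measure_semi_sigma_additive _ _ _ (mscale (NngNum r0) total)).
Qed.

HB.instance Definition _ := isMeasure.Build _ _ _ mu
  mu0 mu_ge0 mu_sigma_additive.

Lemma mu_setT : (0 < n)%N -> (0 < #|A|)%N -> mu setT = 1.
Proof.
move=> n0 A0; rewrite /mu (eq_bigr (fun=> 1)); last first.
  move=> w _; rewrite /occupation (eq_bigr (fun=> 1)); last first.
    by move=> i _; rewrite diracT.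
  rewrite sumEFin big_const_nat iter_addr addr0 subn1 /= -EFinM.
  by rewrite mulVf// pnatr_eq0 -lt0n.
rewrite sumEFin sumr_const -EFinM.
by rewrite mulVf// pnatr_eq0 -lt0n.
Qed.

End WalkMeasure.

Section Limsup.
Context (R : realType) {G : groupType}.

Definition I_limsup (H : set G) (S : {fset G}) : \bar R :=
  limn_esup (fun n =>
    \int[mu R S n.*2]_(g in [set: discrete_group G]) (integrand R H S g)%:E)%E.

End Limsup.

(* Main.v *)
(* Write [F_g = S `&` H^g] for the loops at the vertex [Hg] of the Schreier
   graph and [rho_g] for the spectral radius of [F_g]. Group the words of length
   [n] by the path they trace in [H\G] and by their non-loop letters: inside a
   group, the words returning to 1 in [G] have proportion at most the product of
   [rho_g] over the loop steps, since convolution with [F_g] has norm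
   [#|F_g| * rho_g] on all of l^2(G). Hence the sum over closed words of the
   inverse of this product is at most the number of words ending in [H], which
   is at most [(#|S| * rho(H\G,S)) ^ n]. By Jensen, the exponential growth rate
   of the latter exceeds that of the closed words by the mean of [- ln rho_g]
   over the loop steps of a random closed word. Inserting [s * s^-1] with [s] in
   [F_g] at each time into closed words of length [2n] bounds this mean below by
   [n.*2] times the integral, divided by the ratio of the numbers of closed words
   of lengths [2n + 2] and [2n], which is at most [(#|S| * rho(G,S)) ^ 2]. *)
Require Import Defs.
From HB Require Import structures.
From mathcomp Require Import all_boot all_order all_algebra finmap.
From mathcomp Require Import all_classical all_reals all_analysis.
From mathcomp Require Import ring lra.
Import Order.TTheory GRing.Theory Num.Theory.

Local Open Scope classical_set_scope.
Local Open Scope ring_scope.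

(** * Operators averaging over an action *)

(** Cauchy-Schwarz against the constant family 1; in the induction the cross term is absorbed by
    [(k * a i - u) ^+ 2 >= 0]. *)
Lemma sqr_sum_le (R : realFieldType) (I : Type) (r : seq I) (a : I -> R) :
  (\sum_(i <- r) a i) ^+ 2 <= (size r)%:R * \sum_(i <- r) a i ^+ 2.
Proof.
elim: r => [|i r IH]; first by rewrite !big_nil expr0n mulr0.
rewrite !big_cons /=; set u := \sum_(j <- r) a j in IH *.
set v := \sum_(j <- r) a j ^+ 2 in IH *; rewrite -natr1.
have /= v0 : 0 <= v by apply: sumr_ge0 => j _; exact: sqr_ge0.
have [k0|k0] := eqVneq (size r) 0%N.
  have -> : u = 0 by rewrite /u (size0nil k0) big_nil.
  by have := sqr_ge0 (a i); rewrite k0; nra.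
have k1 : 1 <= (size r)%:R :> R by rewrite ler1n lt0n.
set k := (size r)%:R in IH k1 *.
suff : 2 * a i * u <= k * a i ^+ 2 + v by nra.
have kp : 0 < k by lra.
rewrite -(ler_pM2l kp).
have := sqr_ge0 (k * a i - u); nra.
Qed.

(** * Operator norms through finite sums of squares *)

Section SquareSums.
Context {R : realType} {T : choiceType}.
Implicit Types (X : set T) (f : T -> R) (M : (T -> R) -> (T -> R)).

(** Testing on finite subsets keeps norm bounds among real numbers, with no summability to carry
    along. *)
Definition sqsum_le X f (B : R) : Prop :=
  forall A : {fset T}, [set` A] `<=` X -> \sum_(x <- A) f x ^+ 2 <= B.

Lemma esum_sqr_leP X f B :
  (\esum_(x in X) (f x ^+ 2)%:E <= B%:E)%E <-> sqsum_le X f B.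
Proof.
have E (A : {fset T}) : (\sum_(x \in [set` A]) (f x ^+ 2)%:E)%E =
    (\sum_(x <- A) f x ^+ 2)%:E.
  by rewrite -fsbig_seq ?fset_uniq// sumEFin.
split=> [le_fB A AX|le_fB].
  rewrite -lee_fin -E; apply: le_trans le_fB; apply: ereal_sup_ubound.
  by exists [set` A].
apply: ge_ereal_sup => _ [A [/finite_fsetP[A' ->] AX] <-].
by rewrite E lee_fin; exact: le_fB.
Qed.

Lemma l2norm_leP X f (r : R) : 0 <= r ->
  (l2norm X f <= r%:E)%E <-> sqsum_le X f (r ^+ 2).
Proof.
move=> r0; rewrite -esum_sqr_leP /l2norm.
set e := (\esum_(x in X) _)%E.
have : (0 <= e)%E by apply: esum_ge0 => x _; rewrite lee_fin sqr_ge0.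
case: e => [e| |]// e0.
  rewrite poweR_EFin !lee_fin powR12_sqrt// -{2}(sqr_sqrtr e0).
  by rewrite ler_sqr// nnegrE ?sqrtr_ge0.
by rewrite poweRyr ?invr_neq0// !leye_eq.
Qed.

Lemma l2norm_le1P X f : (l2norm X f <= 1)%E <-> sqsum_le X f 1.
Proof. by rewrite -[X in sqsum_le _ _ X](expr1n _ 2); exact: l2norm_leP. Qed.

Lemma l2norm_ge0 X f : (0 <= l2norm X f)%E.
Proof. exact: poweR_ge0. Qed.

Section BoundedOperator.
Variables (X : set T) (M : (T -> R) -> (T -> R)).
Hypothesis contraction : forall f B, sqsum_le X f B -> sqsum_le X (M f) B.

Lemma sqsum_le_cst0 B : 0 <= B -> sqsum_le X (fun=> 0) B.
Proof. by move=> B0 A _; rewrite big1// => x _; rewrite expr0n. Qed.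

(** The contraction property places the supremum between 0 and 1, so [fine] loses nothing. *)
Lemma opnormE :
  ereal_sup [set l2norm X (M f) | f in [set f | (l2norm X f <= 1)%E]] =
  (opnorm X M)%:E.
Proof.
rewrite /opnorm fineK// fin_real//; set N := ereal_sup _.
have N1 : (N <= 1)%E.
  apply: ge_ereal_sup => _ [f /= /l2norm_le1P f1 <-].
  by apply/l2norm_le1P; exact: contraction.
rewrite (le_lt_trans N1) ?ltry// andbT (lt_le_trans (ltNyr 0))//.
apply: le_trans (l2norm_ge0 X (M (fun=> 0))) _; apply: ereal_sup_ubound => /=.
by exists (fun=> 0) => //; apply/l2norm_le1P; exact: sqsum_le_cst0.
Qed.

Lemma opnorm_ge0 : 0 <= opnorm X M.
Proof.
rewrite -lee_fin -opnormE.
apply: le_trans (l2norm_ge0 X (M (fun=> 0))) _; apply: ereal_sup_ubound => /=.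
by exists (fun=> 0) => //; apply/l2norm_le1P; exact: sqsum_le_cst0.
Qed.

Lemma opnorm_le (r : R) : 0 <= r ->
  (forall f, sqsum_le X f 1 -> sqsum_le X (M f) (r ^+ 2)) -> opnorm X M <= r.
Proof.
move=> r0 Mr; rewrite -lee_fin -opnormE.
apply: ge_ereal_sup => _ [f /= /l2norm_le1P f1 <-].
by apply/(l2norm_leP _ _ _ r0); exact: Mr.
Qed.

Lemma opnorm_le1 : opnorm X M <= 1.
Proof. by apply: opnorm_le => // f f1; rewrite expr1n; exact: contraction. Qed.

Hypothesis homogeneous : forall (k : R) f x, M (fun y => k * f y) x = k * M f x.

(** Scaling by [t^-1] reduces to the unit ball; for [t = 0] the contraction property takes over. *)
Lemma sqsum_le_opnorm f (t : R) : 0 <= t -> sqsum_le X f (t ^+ 2) ->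
  sqsum_le X (M f) ((opnorm X M * t) ^+ 2).
Proof.
rewrite le_eqVlt => /orP[/eqP <-|t0] ft.
  by rewrite mulr0 expr0n /=; apply: contraction; rewrite expr0n /= in ft.
have tn0 : t != 0 by rewrite gt_eqF.
have f1 : sqsum_le X (fun y => t^-1 * f y) 1.
  move=> A AX; under eq_bigr do rewrite exprMn.
  rewrite -mulr_sumr exprVn -ler_pdivlMl ?invr_gt0 ?exprn_gt0// invrK mulr1.
  exact: ft.
have : (l2norm X (M (fun y => t^-1 * f y)%R) <= (opnorm X M)%:E)%E.
  rewrite -opnormE; apply: ereal_sup_ubound; exists (fun y => t^-1 * f y) => //=.
  exact/l2norm_le1P.
move=> /(l2norm_leP _ _ _ opnorm_ge0) Mf1 A AX.
rewrite exprMn mulrC -ler_pdivrMl ?exprn_gt0//.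
have := Mf1 A AX; under eq_bigr do rewrite homogeneous exprMn.
by rewrite -mulr_sumr exprVn.
Qed.

End BoundedOperator.
End SquareSums.

(** * Averages over the letters of a group action *)

Section ActionOperator.
Context {R : realType} {T : choiceType} {G : groupType}.
Variables (act : T -> G -> T) (S : {fset G}).

Definition act_sum (f : T -> R) (x : T) : R := \sum_(s <- S) f (act x s).

(** Convertible to [cayley_op] for right multiplication and to [schreier_op] for right translation
    of cosets, so both norms are treated at once. *)
Definition act_avg (f : T -> R) (x : T) : R := #|` S|%:R^-1 * act_sum f x.

Variable X : set T.
Hypothesis act_stable : forall s x, s \in S -> X x -> X (act x s).
Hypothesis act_inj : forall s x y, s \in S -> X x -> X y ->
  act x s = act y s -> x = y.

(** The square of an average is at most the average of the squares, and each letter maps [A]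
    injectively onto another finite subset of [X]. *)
Lemma act_avg_contraction f B : sqsum_le X f B -> sqsum_le X (act_avg f) B.
Proof.
move=> fB A AX.
have B0 : 0 <= B.
  by have := fB fset0; rewrite big_seq_fset0; apply => x /=.
have [S0|Sn0] := eqVneq #|` S| 0%N.
  by rewrite big1// => x _; rewrite /act_avg S0 invr0 mul0r expr0n.
have Sp : 0 < #|` S|%:R :> R by rewrite ltr0n lt0n.
have trans_le s : s \in S -> \sum_(x <- A) f (act x s) ^+ 2 <= B.
  move=> sS; have <- : \sum_(y <- [fset act x s | x in A]%fset) f y ^+ 2 =
      \sum_(x <- A) f (act x s) ^+ 2.
    apply: big_imfset => x y xA yA /= exy.
    by apply: act_inj exy => //; exact: AX.
  apply: fB => _ /= /imfsetP[x /= xA ->]; apply: act_stable => //.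
  exact: AX.
apply: (@le_trans _ _ (\sum_(x <- A) #|` S|%:R^-1 * \sum_(s <- S) f (act x s) ^+ 2)).
  apply: ler_sum => x _; rewrite /act_avg exprMn /act_sum.
  rewrite [X in X * _]expr2 -mulrA ler_pM2l ?invr_gt0// ler_pdivrMl//.
  exact: sqr_sum_le.
rewrite -mulr_sumr ler_pdivrMl// exchange_big/=.
apply: (@le_trans _ _ (\sum_(s <- S) B)).
  by rewrite big_seq [leRHS]big_seq; apply: ler_sum => s; exact: trans_le.
by rewrite big_const_seq count_predT iter_addr_0 mulr_natl.
Qed.

Lemma act_avgZ k f x : act_avg (fun y => k * f y) x = k * act_avg f x.
Proof. by rewrite /act_avg /act_sum -mulr_sumr mulrCA. Qed.

Lemma act_avg_opnorm_ge0 : 0 <= opnorm X act_avg.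
Proof. by apply: opnorm_ge0; exact: act_avg_contraction. Qed.

Lemma act_avg_opnorm_le1 : opnorm X act_avg <= 1.
Proof. by apply: opnorm_le1; exact: act_avg_contraction. Qed.

Lemma act_avg_opnorm_le (r : R) : 0 <= r ->
  (forall f, sqsum_le X f 1 -> sqsum_le X (act_avg f) (r ^+ 2)) ->
  opnorm X act_avg <= r.
Proof. by move=> r0; apply: opnorm_le => //; exact: act_avg_contraction. Qed.

Lemma act_sumE : S != fset0 -> act_sum = (fun f x => #|` S|%:R * act_avg f x).
Proof.
move=> S0; apply/funext => f; apply/funext => x.
by rewrite /act_avg mulrA divff ?mul1r// pnatr_eq0 cardfs_eq0.
Qed.

Lemma sqsum_le_act_sum f (t : R) : 0 <= t -> sqsum_le X f (t ^+ 2) ->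
  sqsum_le X (act_sum f) ((#|` S|%:R * opnorm X act_avg * t) ^+ 2).
Proof.
move=> t0 ft; have [S0|S0] := eqVneq S fset0.
  move=> A _; rewrite big1 ?sqr_ge0// => x _.
  by rewrite /act_sum S0 big_seq_fset0 expr0n.
move=> A AX; rewrite act_sumE//; under eq_bigr do rewrite exprMn.
rewrite -mulrA [leRHS]exprMn -mulr_sumr ler_wpM2l ?sqr_ge0//.
by apply: sqsum_le_opnorm => //; [exact: act_avg_contraction|exact: act_avgZ].
Qed.

(** The left side counts the words of length [n] that lead [x] back to itself. The indicator of [x]
    has norm at most 1, and a single value is bounded by the norm. *)
Lemma iter_act_sum_le n x : X x ->
  iter n act_sum (fun y => (y == x)%:R) x <= (#|` S|%:R * opnorm X act_avg) ^+ n.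
Proof.
move=> Xx; set r := #|` S|%:R * _.
have r0 : 0 <= r by rewrite mulr_ge0// act_avg_opnorm_ge0.
have : sqsum_le X (iter n act_sum (fun y => (y == x)%:R)) ((r ^+ n) ^+ 2).
  elim: n => [|n IH].
    move=> A _; rewrite expr0 expr1n.
    apply: (@le_trans _ _ (\sum_(y <- A | y == x) (1:R))).
      rewrite [leRHS]big_mkcond /=; apply: ler_sum => y _.
      by case: eqP => _; rewrite ?expr1n// expr0n.
    rewrite big_const_seq iter_addr_0 -/(count_mem x A) count_uniq_mem ?fset_uniq//.
    by case: (_ \in _).
  by rewrite iterS (exprS r); apply: sqsum_le_act_sum; rewrite ?exprn_ge0.
move=> /(_ [fset x]%fset); rewrite big_seq_fset1 => H.
have {}H : iter n act_sum (fun y => (y == x)%:R) x ^+ 2 <= (r ^+ n) ^+ 2.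
  by apply: H => y /=; rewrite inE => /eqP ->.
by apply: le_trans (ler_norm _) _; rewrite -ler_sqr ?nnegrE ?exprn_ge0// real_normK ?num_real.
Qed.

End ActionOperator.

(** * Finitely supported functions on a group *)

(** A constant factor does not change an exponential growth rate: if [y < x], Bernoulli's inequality
    makes [(x / y) ^+ k] exceed [C]. *)
Lemma le_of_expr_le (R : realType) (C x y : R) : 0 <= x -> 0 <= y ->
  (forall k, x ^+ k <= C * y ^+ k) -> x <= y.
Proof.
move=> x0 y0 xy; rewrite leNgt; apply/negP => ltyx.
have [ye|yn0] := eqVneq y 0; first by have := xy 1%N; rewrite ye expr0n mulr0 expr1; lra.
have yp : 0 < y by rewrite lt_def yn0.
pose h := x / y - 1.
have h0 : 0 < h by rewrite subr_gt0 ltr_pdivlMr ?mul1r.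
have bern k : 1 + k%:R * h <= (1 + h) ^+ k.
  elim: k => [|k IH]; first by rewrite mul0r addr0 expr0.
  rewrite exprS -natr1; have kh : 0 <= k%:R * h by rewrite mulr_ge0 ?(ltW h0).
  apply: (@le_trans _ _ ((1 + h) * (1 + k%:R * h))).
    have : 0 <= h * (k%:R * h) by rewrite mulr_ge0// ltW.
    lra.
  by rewrite ler_pM2l//; lra.
have bound k : 1 + k%:R * h <= C.
  apply: le_trans (bern k) _; rewrite /h addrC subrK expr_div_n.
  by rewrite ler_pdivrMr ?exprn_gt0.
have C0 : 0 <= C / h by rewrite divr_ge0 ?(ltW h0)//; have := bound 0%N; lra.
have := archi_boundP C0; set k := Num.bound _ => /ltW.
by rewrite ler_pdivrMr// => Ck; have := bound k; lra.
Qed.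

(** The ratios of successive terms are nondecreasing; denominators are cleared because terms may
    vanish. *)
Lemma logconvex_ratio (R : realFieldType) (b : nat -> R) :
  (forall k, 0 <= b k) -> (forall k, b k.+1 ^+ 2 <= b k * b k.+2) ->
  forall k, b 1%N * b k <= b 0%N * b k.+1.
Proof.
move=> b0 bb; elim=> [|k IH]; first by rewrite mulrC.
have [z|] := eqVneq (b k.+1) 0; first by rewrite z mulr0 mulr_ge0.
rewrite neq_lt ltNge b0 /= => bp.
have bkp : 0 < b k.
  rewrite lt_neqAle b0 andbT eq_sym; apply/eqP => bk.
  by have := bb k; rewrite bk mul0r leNgt exprn_gt0.
rewrite -(ler_pM2r bkp) mulrAC.
apply: (@le_trans _ _ (b 0%N * b k.+1 * b k.+1)); first by rewrite ler_wpM2r.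
by rewrite -!mulrA -expr2; apply: ler_wpM2l => //; rewrite [leRHS]mulrC.
Qed.

Lemma logconvex_expr (R : realFieldType) (b : nat -> R) :
  (forall k, 0 <= b k) -> (forall k, b k.+1 ^+ 2 <= b k * b k.+2) ->
  forall k, b 1%N ^+ k * b 0%N <= b 0%N ^+ k * b k.
Proof.
move=> b0 bb; elim=> [|k IH]; first by rewrite !expr0.
rewrite !exprS -mulrA.
apply: (@le_trans _ _ (b 1%N * (b 0%N ^+ k * b k))); first by rewrite ler_wpM2l.
rewrite mulrCA -mulrA [leRHS]mulrCA; apply: ler_wpM2l; first exact: exprn_ge0.
exact: logconvex_ratio.
Qed.

Section GroupFunctions.
Context {R : realType} {G : groupType}.
Implicit Types (u v f : G -> R) (E F : {fset G}) (g s x y : G).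

Definition supported f E : Prop := forall x, x \notin E -> f x = 0.

Definition finitely_supported f : Prop := exists E, supported f E.

(* A [\sum] over an infinite set is 0 unless the summand has finite support. *)
Definition dot u v : R := \sum_(x \in [set: G]) u x * v x.

Definition sqn f : R := dot f f.

Lemma dotE E u v : supported v E -> dot u v = \sum_(x <- E) u x * v x.
Proof. by move=> vE; apply: fsbigTE => x /vE ->; rewrite mulr0. Qed.

Lemma sqnE E f : supported f E -> sqn f = \sum_(x <- E) f x ^+ 2.
Proof. by move=> fE; rewrite /sqn (dotE _ _ _ fE); apply: eq_bigr. Qed.

Lemma sqn_ge0 f : 0 <= sqn f.
Proof. by apply: fsumr_ge0 => x _; rewrite -expr2 sqr_ge0. Qed.

Lemma supportedW E E' f : (E `<=` E')%fset -> supported f E -> supported f E'.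
Proof. by move=> EE' fE x xE'; apply: fE; apply: contra xE'; apply/fsubsetP. Qed.

Lemma supportedU E E' u v : supported u E -> supported v E' ->
  supported u (E `|` E')%fset /\ supported v (E `|` E')%fset.
Proof.
by move=> uE vE; split; [apply: supportedW uE|apply: supportedW vE];
  rewrite ?fsubsetUl ?fsubsetUr.
Qed.

Lemma sum_sqr_le_sqn E f : finitely_supported f ->
  \sum_(x <- E) f x ^+ 2 <= sqn f.
Proof.
move=> [E' fE'].
have fE : supported f (E `|` E')%fset by apply: supportedW fE'; rewrite fsubsetUr.
rewrite (sqnE _ _ fE) [leRHS](big_fsetID _ (mem E))/=.
rewrite (_ : [fset x in _ | _]%fset = E); last first.
  by apply/fsetP => x; rewrite !inE /=; case: (x \in E); rewrite ?andbF.
by rewrite lerDl; apply: sumr_ge0 => x _; exact: sqr_ge0.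
Qed.

Lemma sqr_le_sqn f x : finitely_supported f -> f x ^+ 2 <= sqn f.
Proof. by move=> /(sum_sqr_le_sqn [fset x]%fset); rewrite big_seq_fset1. Qed.

Lemma dot_sqr_le u v : finitely_supported u -> finitely_supported v ->
  dot u v ^+ 2 <= sqn u * sqn v.
Proof.
move=> [Eu uE] [Ev vE].
have [{}uE {}vE] := supportedU _ _ _ _ uE vE; move: uE vE.
set E := (Eu `|` Ev)%fset => uE vE.
have key (a b : R) : 0 <= a ^+ 2 * sqn u - 2 * a * b * dot u v + b ^+ 2 * sqn v.
  rewrite (sqnE _ _ uE) (sqnE _ _ vE) (dotE _ _ _ vE) !mulr_sumr -sumrB -big_split/=.
  by apply: sumr_ge0 => x _; have := sqr_ge0 (a * u x - b * v x); nra.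
have := sqn_ge0 v; rewrite le_eqVlt => /orP[/eqP v0|vp].
  suff -> : dot u v = 0 by rewrite expr0n -v0 mulr0.
  rewrite (dotE _ _ _ vE) big_seq big1// => x xE.
  suff -> : v x = 0 by rewrite mulr0.
  apply/eqP; rewrite -sqrf_eq0 eq_le sqr_ge0 andbT v0; apply: sqr_le_sqn.
  by exists E.
rewrite -subr_ge0 -(pmulr_rge0 _ vp).
(* With these coefficients the quadratic form is [sqn v] times the difference to be shown
   nonnegative. *)
apply: le_trans (key (sqn v) (dot u v)) _.
by rewrite le_eqVlt; apply/orP; left; apply/eqP; ring.
Qed.

Lemma bij_mulg s : bijective (fun x => (x * s)%g).
Proof. by exists (fun x => (x * s^-1)%g) => x; rewrite ?mulgK ?mulgVK. Qed.

Lemma bij_lmulg s : bijective (fun x => (s * x)%g).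
Proof. by exists (fun x => (s^-1 * x)%g) => x; rewrite ?mulKg ?mulVKg. Qed.

Lemma dot_translate u v s :
  dot (fun x => u (x * s)%g) v = dot u (fun x => v (x * s^-1)%g).
Proof.
rewrite /dot [RHS](reindex_fsbigT _ _ (bij_mulg s)).
by apply: eq_fsbigr => x _ /=; rewrite mulgK.
Qed.

Lemma sqn_translate f s : sqn (fun x => f (x * s)%g) = sqn f.
Proof. by rewrite /sqn /dot [RHS](reindex_fsbigT _ _ (bij_mulg s)). Qed.

Lemma sqn_ltranslate f s : sqn (fun x => f (s * x)%g) = sqn f.
Proof. by rewrite /sqn /dot [RHS](reindex_fsbigT _ _ (bij_lmulg s)). Qed.

Lemma finitely_supported_translate f s :
  finitely_supported f -> finitely_supported (fun x => f (x * s)%g).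
Proof.
move=> [E fE]; exists [fset (x * s^-1)%g | x in E]%fset => x xE; apply: fE.
by apply: contra xE => xs; apply/imfsetP; exists (x * s)%g; rewrite ?mulgK.
Qed.

Lemma finitely_supported_ltranslate f s :
  finitely_supported f -> finitely_supported (fun x => f (s * x)%g).
Proof.
move=> [E fE]; exists [fset (s^-1 * x)%g | x in E]%fset => x xE; apply: fE.
by apply: contra xE => xs; apply/imfsetP; exists (s * x)%g; rewrite ?mulKg.
Qed.

Lemma finitely_supportedZ c f :
  finitely_supported f -> finitely_supported (fun x => c * f x).
Proof. by move=> [E fE]; exists E => x /fE ->; rewrite mulr0. Qed.

Lemma sqnZ c f : sqn (fun x => c * f x) = c ^+ 2 * sqn f.
Proof.
by rewrite /sqn /dot mulr_fsumr; apply: eq_fsbigr => x _; rewrite mulrACA -expr2.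
Qed.

Lemma common_support (I : eqType) (r : seq I) (h : I -> G -> R) :
  (forall i, finitely_supported (h i)) ->
  exists E, forall i, i \in r -> supported (h i) E.
Proof.
move=> hf; elim: r => [|i r [E hE]]; first by exists fset0.
have [Ei hi] := hf i; exists (Ei `|` E)%fset => j.
rewrite inE => /orP[/eqP ->|/hE hj].
  by apply: supportedW hi; rewrite fsubsetUl.
by apply: supportedW hj; rewrite fsubsetUr.
Qed.

Lemma supported_sum (I : eqType) (r : seq I) (h : I -> G -> R) E :
  (forall i, i \in r -> supported (h i) E) ->
  supported (fun x => \sum_(i <- r) h i x) E.
Proof. by move=> hE x xE; rewrite big_seq big1// => i /hE; apply. Qed.

Lemma finitely_supported_sum (I : eqType) (r : seq I) (h : I -> G -> R) :
  (forall i, finitely_supported (h i)) ->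
  finitely_supported (fun x => \sum_(i <- r) h i x).
Proof.
by move=> /(common_support _ r)[E hE]; exists E; exact: supported_sum.
Qed.

Lemma dot_sumr (I : eqType) (r : seq I) u (h : I -> G -> R) :
  (forall i, finitely_supported (h i)) ->
  dot u (fun x => \sum_(i <- r) h i x) = \sum_(i <- r) dot u (h i).
Proof.
move=> /(common_support _ r)[E hE]; rewrite (dotE _ _ _ (supported_sum _ _ _ _ hE)).
under eq_bigr do rewrite mulr_sumr.
rewrite exchange_big/= big_seq [RHS]big_seq; apply: eq_bigr => i ir.
by rewrite (dotE E)//; exact: hE.
Qed.

Lemma dot_suml (I : eqType) (r : seq I) (h : I -> G -> R) v :
  finitely_supported v ->
  dot (fun x => \sum_(i <- r) h i x) v = \sum_(i <- r) dot (h i) v.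
Proof.
move=> [E vE]; rewrite (dotE E)//; under eq_bigr do rewrite mulr_suml.
by rewrite exchange_big/=; apply: eq_bigr => i _; rewrite (dotE E).
Qed.

Lemma sqn_sum_le (I : eqType) (r : seq I) (h : I -> G -> R) :
  (forall i, finitely_supported (h i)) ->
  sqn (fun x => \sum_(i <- r) h i x) <= (size r)%:R * \sum_(i <- r) sqn (h i).
Proof.
move=> /(common_support _ r)[E hE]; rewrite (sqnE _ _ (supported_sum _ _ _ _ hE)).
rewrite [X in _ * X](_ : _ = \sum_(x <- E) \sum_(i <- r) h i x ^+ 2).
  by rewrite mulr_sumr; apply: ler_sum => x _; exact: sqr_sum_le.
rewrite exchange_big/= big_seq [RHS]big_seq; apply: eq_bigr => i ir.
by apply: sqnE; exact: hE.
Qed.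

End GroupFunctions.

(** * Convolution and return probabilities *)

Section Subgroups.
Context {G : groupType}.
Implicit Types (H M : set G) (x y g : G).

Lemma subgroup1 H : subgroup H -> H 1%g.
Proof. by case=> /set_mem. Qed.

Lemma subgroupV H x : subgroup H -> H x -> H x^-1%g.
Proof.
by move=> [H1 Hd] /mem_set Hx; have /set_mem := Hd _ _ H1 Hx; rewrite div1g.
Qed.

Lemma subgroupM H x y : subgroup H -> H x -> H y -> H (x * y)%g.
Proof.
move=> sH Hx /(subgroupV _ _ sH) Hy; case: (sH) => _ Hd.
by have /set_mem := Hd _ _ (mem_set Hx) (mem_set Hy); rewrite invgK.
Qed.

Lemma subgroupMr H x y : subgroup H -> H y -> H (x * y)%g <-> H x.
Proof.
move=> sH Hy; split=> [Hxy|Hx]; last exact: subgroupM.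
by rewrite -(mulgK y x); apply: subgroupM => //; exact: subgroupV.
Qed.

Lemma subgroupMl H x y : subgroup H -> H y -> H (y * x)%g <-> H x.
Proof.
move=> sH Hy; split=> [Hxy|Hx]; last exact: subgroupM.
by rewrite -(mulKg y x); apply: subgroupM => //; exact: subgroupV.
Qed.

Lemma gen1 H : gen H 1%g.
Proof. by move=> M [sM _]; exact: subgroup1. Qed.

Lemma genM H x s : gen H x -> H s -> gen H (x * s)%g.
Proof.
move=> Hx Hs M [sM HM]; apply: subgroupM => //; last exact: HM.
exact: Hx.
Qed.

End Subgroups.

Definition symmetric_fset {G : groupType} (F : {fset G}) : Prop :=
  forall s, s \in F -> (s^-1)%g \in F.

Lemma big_symmetric {R : realType} {G : groupType} (F : {fset G}) (h : G -> R) :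
  symmetric_fset F -> \sum_(s <- F) h (s^-1)%g = \sum_(s <- F) h s.
Proof.
move=> sF.
have {2}-> : F = [fset (s^-1)%g | s in F]%fset.
  apply/fsetP => s; apply/idP/imfsetP => [sF'|[t /= tF ->]]; last exact: sF.
  by exists (s^-1)%g; rewrite ?invgK//=; exact: sF.
by rewrite big_imfset//= => x y _ _; exact: invg_inj.
Qed.

Section Convolution.
Context {R : realType} {G : groupType}.
Implicit Types (u v f : G -> R) (E F : {fset G}) (g s x y : G).

(** Left unnormalized, so that iterates on [delta1] count words: the value at [x] is the number of
    words leading from [x] to 1. *)
Definition conv F : (G -> R) -> G -> R := act_sum (fun x s => (x * s)%g) F.

Definition delta1 x : R := (x == 1%g)%:R.

Lemma finitely_supported_delta1 : finitely_supported delta1.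
Proof. by exists [fset 1%g]%fset => x; rewrite inE /delta1 => /negbTE ->. Qed.

Lemma finitely_supported_conv F f :
  finitely_supported f -> finitely_supported (conv F f).
Proof.
move=> ff; apply: (finitely_supported_sum _ (enum_fset F) (fun s x => f (x * s)%g)).
by move=> s; exact: finitely_supported_translate.
Qed.

Lemma finitely_supported_iter_conv F f k :
  finitely_supported f -> finitely_supported (iter k (conv F) f).
Proof. by move=> ff; elim: k => //= k; exact: finitely_supported_conv. Qed.

Lemma sqn_delta1 : sqn delta1 = 1.
Proof.
rewrite (sqnE [fset 1%g]%fset) ?big_seq_fset1 /delta1 ?eqxx ?expr1n//.
by move=> x; rewrite inE => /negbTE ->.
Qed.

Section Symmetric.
Variable F : {fset G}.
Hypothesis F_sym : symmetric_fset F.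

(** Translation by [s] has translation by [s^-1] as adjoint, and [F] is symmetric. *)
Lemma dot_conv u v : finitely_supported v -> dot (conv F u) v = dot u (conv F v).
Proof.
move=> fv; rewrite (dot_suml _ (enum_fset F) (fun s x => u (x * s)%g))//.
rewrite (dot_sumr _ (enum_fset F) u (fun s x => v (x * s)%g)); last first.
  by move=> s; exact: finitely_supported_translate.
rewrite -(big_symmetric F (fun s => dot u (fun x => v (x * s)%g)))//.
by apply: eq_bigr => s _; rewrite dot_translate.
Qed.

(** Self-adjointness moves half of the convolutions across the inner product, so the numbers of
    closed words of even length are squared norms. *)
Lemma sqn_iter_conv_delta1 k :
  sqn (iter k (conv F) delta1) = iter (k + k) (conv F) delta1 1%g.
Proof.
have E j : dot (iter (k + j) (conv F) delta1) delta1 =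
    dot (iter k (conv F) delta1) (iter j (conv F) delta1).
  elim: j k => [|j IH] k; first by rewrite addn0.
  rewrite -addSnnS IH iterS dot_conv//.
  exact/finitely_supported_iter_conv/finitely_supported_delta1.
rewrite /sqn -E (dotE [fset 1%g]%fset).
  by rewrite big_seq_fset1 /delta1 eqxx mulr1.
by move=> x; rewrite inE /delta1 => /negbTE ->.
Qed.

(** Self-adjointness turns the squared norm of iterate [k + 1] into the inner product of iterates
    [k] and [k + 2]; Cauchy-Schwarz then applies. *)
Lemma sqn_iter_conv_logconvex f : finitely_supported f -> forall k,
  sqn (iter k.+1 (conv F) f) ^+ 2 <=
  sqn (iter k (conv F) f) * sqn (iter k.+2 (conv F) f).
Proof.
move=> ff k; rewrite {1}/sqn {1}iterS dot_conv; last exact: finitely_supported_iter_conv.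
apply: dot_sqr_le; first exact: finitely_supported_iter_conv.
exact: (finitely_supported_iter_conv F f k.+2).
Qed.

(** [f] is a combination of left translates of [delta1], and left translation is an isometry
    commuting with [conv F]. *)
Lemma sqn_iter_conv_le E f k : supported f E ->
  sqn (iter k (conv F) f) <=
  #|` E|%:R * (sqn f * sqn (iter k (conv F) delta1)).
Proof.
move=> fE.
have -> : iter k (conv F) f =
    fun x => \sum_(y <- E) f y * iter k (conv F) delta1 (y^-1 * x)%g.
  elim: k => [|k IH]; apply/funext => x.
    rewrite /= /delta1; under eq_bigr do rewrite mulg_eq1 (inj_eq invg_inj).
    have [xE|xE] := boolP (x \in E).
      rewrite (big_fsetD1 x)//= eqxx mulr1 big_seq big1 ?addr0// => y.
      by rewrite !inE => /andP[/negbTE -> _]; rewrite mulr0.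
    rewrite fE// big_seq big1// => y yE; case: eqP => [yx|_]; rewrite ?mulr0//.
    by rewrite yx (negbTE xE) in yE.
  rewrite iterS IH /conv /act_sum exchange_big/=; apply: eq_bigr => y _.
  by rewrite mulr_sumr; apply: eq_bigr => s _; rewrite mulgA.
apply: le_trans (sqn_sum_le _ _ (fun y x => f y * iter k (conv F) delta1 (y^-1 * x)%g) _) _.
  move=> y; apply: finitely_supportedZ.
  apply: finitely_supported_ltranslate.
  exact/finitely_supported_iter_conv/finitely_supported_delta1.
rewrite ler_wpM2l// (sqnE _ _ fE) mulr_suml; apply: ler_sum => y _.
by rewrite (sqnZ (f y) (fun x => iter k (conv F) delta1 (y^-1 * x)%g)) sqn_ltranslate.
Qed.

(* Log-convexity makes [sqn (conv F f) / sqn f] a lower bound for the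
   exponential growth rate of [sqn (iter k (conv F) f)], which the return
   probabilities dominate. *)
Lemma sqn_conv_le_of_return (lam : R) : 0 <= lam ->
  (forall k, sqn (iter k (conv F) delta1) <= lam ^+ k) ->
  forall f, finitely_supported f -> sqn (conv F f) <= lam * sqn f.
Proof.
move=> lam0 ret f ff; pose b k := sqn (iter k (conv F) f).
have b_ge0 k : 0 <= b k by exact: sqn_ge0.
have b_conv := sqn_iter_conv_logconvex _ ff.
rewrite -[sqn f]/(b 0%N) -[sqn (conv F f)]/(b 1%N).
have [b0|b0] := eqVneq (b 0%N) 0.
  have := b_conv 0%N; rewrite -!/(b _) b0 mul0r mulr0.
  by rewrite exprn_even_le0//= => /eqP ->.
have bp : 0 < b 0%N by rewrite lt_def b0 b_ge0.
rewrite -ler_pdivrMr//; have [E fE] := ff.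
(* The size of the support is a constant, which does not affect growth in [k]. *)
apply: (@le_of_expr_le _ #|` E|%:R) => // [|k]; first by rewrite divr_ge0.
rewrite expr_div_n ler_pdivrMr ?exprn_gt0// -(ler_pM2r bp).
apply: le_trans (logconvex_expr _ _ b_ge0 b_conv k) _.
apply: (@le_trans _ _ (b 0%N ^+ k * (#|` E|%:R * (b 0%N * lam ^+ k)))).
  rewrite ler_wpM2l ?exprn_ge0//; apply: le_trans (sqn_iter_conv_le _ _ _ fE) _.
  by apply: ler_wpM2l => //; apply: ler_wpM2l => //; exact: sqn_ge0.
by rewrite le_eqVlt; apply/orP; left; apply/eqP; ring.
Qed.

End Symmetric.

Lemma rho_cayley_ge0 K F : (forall s x, s \in F -> K x -> K (x * s)%g) ->
  0 <= rho_cayley R K F.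
Proof.
by move=> KF; apply: act_avg_opnorm_ge0 => // s x y _ _ _; exact: mulIg.
Qed.

Lemma rho_cayley_le1 K F : (forall s x, s \in F -> K x -> K (x * s)%g) ->
  rho_cayley R K F <= 1.
Proof.
by move=> KF; apply: act_avg_opnorm_le1 => // s x y _ _ _; exact: mulIg.
Qed.

Lemma return_le_rho K F n : (forall s x, s \in F -> K x -> K (x * s)%g) ->
  K 1%g -> iter n (conv F) delta1 1%g <= (#|` F|%:R * rho_cayley R K F) ^+ n.
Proof.
by move=> KF K1; apply: iter_act_sum_le => // s x y _ _ _; exact: mulIg.
Qed.

(** The norm on [K] alone controls the convolution on all of [G], because it already bounds the
    return counts at 1, which govern the growth of every finitely supported function. *)
Lemma sqn_conv_le_rho K F f : (forall s x, s \in F -> K x -> K (x * s)%g) ->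
  K 1%g -> symmetric_fset F -> finitely_supported f ->
  sqn (conv F f) <= (#|` F|%:R * rho_cayley R K F) ^+ 2 * sqn f.
Proof.
move=> KF K1 sF; apply: sqn_conv_le_of_return => //; first exact: sqr_ge0.
move=> k; rewrite sqn_iter_conv_delta1// -exprM mul2n -addnn.
exact: return_le_rho.
Qed.

(** On a finite set [A] the average of [f] sees only the values of [f] on the products of [A] with
    [F], so [f] may be cut off outside this finite set. *)
Lemma rho_cayley_le_of_sqn F (lam : R) : 0 <= lam -> F != fset0 ->
  (forall f, finitely_supported f -> sqn (conv F f) <= lam * sqn f) ->
  (#|` F|%:R * rho_cayley R [set: G] F) ^+ 2 <= lam.
Proof.
move=> lam0 F0 Flam.
have cF : 0 < #|` F|%:R :> R by rewrite ltr0n cardfs_gt0.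
suff H : rho_cayley R [set: G] F <= Num.sqrt lam / #|` F|%:R.
  rewrite -[leRHS]sqr_sqrtr// ler_sqr ?nnegrE ?mulr_ge0 ?sqrtr_ge0 ?rho_cayley_ge0//.
  by rewrite mulrC -ler_pdivlMr.
apply: act_avg_opnorm_le => // [s x y _ _ _|f f1 A _]; first exact: mulIg.
pose E := [fset (x * s)%g | x in A, s in F]%fset.
pose f' x := if x \in E then f x else 0.
have f'E : supported f' E by move=> x /negbTE xE; rewrite /f' xE.
have ff' : finitely_supported f' by exists E.
apply: (@le_trans _ _ (#|` F|%:R^-1 ^+ 2 * sqn (conv F f'))).
  apply: (@le_trans _ _ (#|` F|%:R^-1 ^+ 2 * \sum_(x <- A) conv F f' x ^+ 2)).
    rewrite mulr_sumr big_seq [leRHS]big_seq; apply: ler_sum => x xA.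
    rewrite /act_avg exprMn ler_wpM2l ?sqr_ge0//.
    rewrite le_eqVlt; apply/orP; left; apply/eqP; congr (_ ^+ 2).
    rewrite /conv /act_sum big_seq [RHS]big_seq; apply: eq_bigr => s sF.
    by rewrite /f' ifT//; apply/imfset2P; exists x => //; exists s.
  rewrite ler_wpM2l ?sqr_ge0//; apply: sum_sqr_le_sqn.
  exact: finitely_supported_conv.
rewrite exprMn sqr_sqrtr// exprVn [leRHS]mulrC ler_wpM2l ?invr_ge0 ?sqr_ge0//.
apply: le_trans (Flam _ ff') _; rewrite ler_piMr//.
rewrite (sqnE _ _ f'E); apply: le_trans (f1 E _) => //.
rewrite big_seq [leRHS]big_seq; apply: ler_sum => x xE.
by rewrite /f' xE.
Qed.

End Convolution.

(** * Walks weighted by their loops *)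

Section WordSums.
Context {R : realType} {G : groupType}.
Variable S : {fset G}.
Implicit Types (P Q : seq G -> R) (g s x : G) (w : seq G) (n : nat).

(** Recursive in the first letter, so that inductions peel off one step of the walk. *)
Fixpoint word_sum n P : R :=
  if n is m.+1 then \sum_(s <- S) word_sum m (fun w => P (s :: w)) else P [::].

Definition word_prod w : G := \big[*%g/1%g]_(a <- w) a.

Lemma word_prod_nil : word_prod [::] = 1%g.
Proof. by rewrite /word_prod big_nil. Qed.

Lemma word_prod_cons s w : word_prod (s :: w) = (s * word_prod w)%g.
Proof. by rewrite /word_prod big_cons. Qed.

Lemma ler_word_sum n P Q : (forall w, size w = n -> P w <= Q w) ->
  word_sum n P <= word_sum n Q.
Proof.
elim: n P Q => [|n IH] P Q PQ /=; first exact: PQ.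
by apply: ler_sum => s _; apply: IH => w wn; apply: PQ; rewrite /= wn.
Qed.

Lemma eq_word_sum n P Q : P =1 Q -> word_sum n P = word_sum n Q.
Proof. by move=> /funext ->. Qed.

Lemma word_sumD n P Q :
  word_sum n (fun w => P w + Q w) = word_sum n P + word_sum n Q.
Proof.
by elim: n P Q => [|n IH] P Q //=; rewrite -big_split; apply: eq_bigr.
Qed.

Lemma word_sumZ n c P : word_sum n (fun w => c * P w) = c * word_sum n P.
Proof.
by elim: n P => [|n IH] P //=; rewrite mulr_sumr; apply: eq_bigr.
Qed.

Lemma word_sum_sum (I : Type) (r : seq I) n (h : I -> seq G -> R) :
  word_sum n (fun w => \sum_(i <- r) h i w) = \sum_(i <- r) word_sum n (h i).
Proof.
elim: n h => [|n IH] h //=.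
by rewrite exchange_big/=; apply: eq_bigr => s _; exact: IH.
Qed.

Lemma word_sum_ge0 n P : (forall w, 0 <= P w) -> 0 <= word_sum n P.
Proof.
elim: n P => [|n IH] P P0 //=.
by apply: sumr_ge0 => s _; apply: IH.
Qed.

Lemma iter_convE n f x :
  iter n (conv S) f x = word_sum n (fun w => f (x * word_prod w)%g).
Proof.
elim: n x => [|n IH] x; first by rewrite /= word_prod_nil mulg1.
rewrite iterS /conv /act_sum/=; apply: eq_bigr => s _.
rewrite IH; apply: eq_word_sum => w.
by rewrite word_prod_cons mulgA.
Qed.

(* Jensen's inequality for exp, via its tangent line at the mean. *)
Lemma word_sum_expR_ge n (P Y : seq G -> R) : (forall w, 0 <= P w) ->
  0 < word_sum n P ->
  word_sum n P * expR (word_sum n (fun w => Y w * P w) / word_sum n P) <=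
  word_sum n (fun w => expR (Y w) * P w).
Proof.
move=> P0 cp; set c := word_sum n P in cp *; set d := word_sum n _.
pose m := d / c.
have H w : expR m * ((1 - m) * P w + Y w * P w) <= expR (Y w) * P w.
  have -> : Y w = m + (Y w - m) by rewrite addrC subrK.
  rewrite expRD -mulrA ler_pM2l ?expR_gt0//.
  have := expR_ge1Dx (Y w - m) => /(ler_wpM2r (P0 w)) Hw.
  by apply: le_trans Hw; rewrite le_eqVlt; apply/orP; left; apply/eqP; ring.
apply: le_trans (ler_word_sum n _ _ (fun w _ => H w)).
rewrite word_sumZ word_sumD word_sumZ -/c -/d -/m mulrC ler_pM2l ?expR_gt0//.
have -> : d = m * c by rewrite /m divfK// gt_eqF.
by rewrite le_eqVlt; apply/orP; left; apply/eqP; ring.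
Qed.

End WordSums.

(** * Loops of the Schreier graph and weighted walks *)

Section Loops.
Context {R : realType} {G : groupType}.
Variables (S : {fset G}) (H : set G).
Hypothesis S_sym : symmetric_fset S.
Hypothesis H_subgroup : subgroup H.
Implicit Types (g s x h : G) (w : seq G) (n m : nat).

Lemma conj_setE g x : conj_set H g x <-> H (g * x * g^-1)%g.
Proof.
split=> [[h Hh <-]|Hx].
  by rewrite conjgE !mulgA mulgV mul1g mulgK.
by exists (g * x * g^-1)%g => //; rewrite conjgE !mulgA mulgVK mulVg mul1g.
Qed.

Lemma conj_set_lmul h g : H h -> conj_set H (h * g)%g = conj_set H g.
Proof.
move=> Hh; apply/funext => x; apply/propext; rewrite !conj_setE invgM.
rewrite (_ : (h * g * x * (g^-1 * h^-1) = h * (g * x * g^-1) * h^-1)%g) ?mulgA//.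
rewrite -!mulgA mulgA -mulgA subgroupMl// !mulgA subgroupMr//.
exact: subgroupV.
Qed.

Lemma rtranslate_lmul h g : H h -> rtranslate H (h * g)%g = rtranslate H g.
Proof.
move=> Hh; apply/seteqP; split=> _ [a Ha <-].
  by exists (a * h)%g; [exact: subgroupM|rewrite mulgA].
exists (a * h^-1)%g; last by rewrite mulgA mulgVK.
by apply: subgroupM => //; exact: subgroupV.
Qed.

Lemma rtranslateE g x : rtranslate H g x <-> H (x * g^-1)%g.
Proof.
split=> [[a Ha <-]|Hx]; first by rewrite mulgK.
by exists (x * g^-1)%g; rewrite ?mulgVK.
Qed.

Lemma rtranslateM (A : set G) g s : rtranslate (rtranslate A g) s = rtranslate A (g * s)%g.
Proof.
apply/seteqP; split=> [_ [_ [a Aa <-] <-]|_ [a Aa <-]].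
  by exists a => //; rewrite mulgA.
by exists (a * g)%g; [exists a|rewrite mulgA].
Qed.

Lemma rtranslate1 (A : set G) : rtranslate A 1%g = A.
Proof.
apply/seteqP; split=> [_ [a Aa <-]|a Aa]; first by rewrite mulg1.
by exists a; rewrite ?mulg1.
Qed.

Lemma rtranslate_subgroup g : H g -> rtranslate H g = H.
Proof. by move=> Hg; rewrite -(mulg1 g) rtranslate_lmul// rtranslate1. Qed.

Definition loops g : {fset G} := fset_inter S (conj_set H g).

Definition loop_rate g : R := - ln (rho_cayley R (gen [set` loops g]) (loops g)).

(** Its exponential is the inverse of the product of the spectral radii met at the loop steps of the
    walk from [g]. *)
Fixpoint loop_gain g w : R :=
  if w is s :: w' then
    (if s \in loops g then loop_rate g else 0) + loop_gain (g * s)%g w'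
  else 0.

(** Includes the starting position, where a loop can be inserted as well. *)
Fixpoint integrand_sum g w : R :=
  integrand R H S g + (if w is s :: w' then integrand_sum (g * s)%g w' else 0).

Lemma integrandE g : integrand R H S g = #|` loops g|%:R * loop_rate g.
Proof. by []. Qed.

Lemma loopsP g s : s \in loops g -> s \in S /\ H (g * s * g^-1)%g.
Proof.
by rewrite !inE /= => /andP[sS]; rewrite inE => /conj_setE.
Qed.

Lemma loops_lmul h g : H h -> loops (h * g)%g = loops g.
Proof. by move=> Hh; rewrite /loops conj_set_lmul. Qed.

Lemma loops_sym g : symmetric_fset (loops g).
Proof.
move=> s /loopsP[sS Hs]; rewrite !inE /= S_sym//=; apply/mem_set/conj_setE.
have -> : (g * s^-1 * g^-1 = (g * s * g^-1)^-1)%g by rewrite !invgM invgK mulgA.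
exact: subgroupV.
Qed.

Lemma loop_gain_lmul h g w : H h -> loop_gain (h * g)%g w = loop_gain g w.
Proof.
move=> Hh; elim: w g => [//|s w IH] g /=.
by rewrite /loop_rate loops_lmul// -mulgA IH.
Qed.

(** A loop stays in the coset [Hg], on which alone the gain depends. *)
Lemma loop_gain_loop g s w : s \in loops g ->
  loop_gain (g * s)%g w = loop_gain g w.
Proof.
move=> /loopsP[_ Hs]; rewrite -[RHS](loop_gain_lmul (g * s * g^-1)%g)//.
by rewrite mulgVK.
Qed.

Lemma gen_loops g : forall s x, s \in loops g ->
  gen [set` loops g] x -> gen [set` loops g] (x * s)%g.
Proof. by move=> s x sg gx; apply: genM. Qed.

Lemma loop_rate_ge0 g : 0 <= loop_rate g.
Proof.
rewrite oppr_ge0; apply: ln_le0; apply: rho_cayley_le1; exact: gen_loops.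
Qed.

Lemma integrand_ge0 g : 0 <= integrand R H S g.
Proof. by rewrite integrandE mulr_ge0// loop_rate_ge0. Qed.

Lemma loop_gain_ge0 g w : 0 <= loop_gain g w.
Proof.
elim: w g => //= s w IH g; rewrite addr_ge0//.
by case: ifP => // _; exact: loop_rate_ge0.
Qed.

(** Prepend [s^-1] to each word leading from [x] to 1. *)
Lemma return2_ge (F : {fset G}) n x s : symmetric_fset F -> s \in F ->
  iter n (conv F) (@delta1 R G) x <= iter n.+1 (conv F) delta1 (x * s)%g.
Proof.
move=> sF sF'; rewrite [iter n.+1 _ _]iterS {2}/conv /act_sum.
rewrite (big_fsetD1 (s^-1)%g) ?sF//= mulgK lerDl sumr_ge0// => t _.
rewrite iter_convE; apply: word_sum_ge0 => w; exact: ler0n.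
Qed.

(** The word [s s^-1] is closed, which a zero radius would exclude. Positivity makes
    [expR (loop_rate g)] the true inverse of the radius. *)
Lemma rho_loops_gt0 g : loops g != fset0 ->
  0 < rho_cayley R (gen [set` loops g]) (loops g).
Proof.
move=> /fset0Pn[s sg]; rewrite lt_def rho_cayley_ge0 ?andbT; last exact: gen_loops.
apply/eqP => rho0.
have := @return_le_rho R G _ (loops g) 2 (gen_loops g) (gen1 _).
rewrite rho0 mulr0 expr0n leNgt /=; apply/negP; rewrite negbK.
rewrite {1}/conv /act_sum (big_fsetD1 s)//=; apply: ltr_wpDr.
  apply: sumr_ge0 => t _; apply: sumr_ge0 => t' _; exact: ler0n.
apply: lt_le_trans (return2_ge (loops g) 0 1%g s (loops_sym g) sg).
by rewrite /= /delta1 eqxx ltr01.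
Qed.

(** The cardinal factor covers the case without loops, where both sides vanish. *)
Lemma expR_loop_rate g :
  expR (loop_rate g) * (#|` loops g|%:R * rho_cayley R (gen [set` loops g]) (loops g))
  = #|` loops g|%:R.
Proof.
have [->|/rho_loops_gt0 rp] := eqVneq (loops g) fset0.
  by rewrite cardfs0 mul0r mulr0.
rewrite /loop_rate expRN lnK ?posrE// mulrCA mulVf ?mulr1//.
by rewrite gt_eqF.
Qed.

Definition coset_walks n (C : set G) : R :=
  iter n (act_sum rtranslate S) (fun D : set G => (D == H)%:R) C.

Lemma coset_walks_ge0 n C : 0 <= coset_walks n C.
Proof.
rewrite /coset_walks; elim: n C => [|n IH] C /=; first exact: ler0n.
by apply: sumr_ge0.
Qed.

Lemma coset_walksS n C :
  coset_walks n.+1 C = \sum_(s <- S) coset_walks n (rtranslate C s).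
Proof. by []. Qed.

(* Consecutive loops at [Hg] are grouped into one application of [conv (loops g)],
   whose norm is [#|loops g| * rho]; the factor [rho] is absorbed by the weight
   [expR (loop_rate g)], and every other step has norm 1. *)
Lemma weighted_walks_le n g (f : G -> R) : finitely_supported f ->
  (forall x, f x != 0 -> rtranslate H g x) ->
  word_sum S n (fun w => expR (loop_gain g w) * f (word_prod w)^-1%g) <=
  coset_walks n (rtranslate H g) * Num.sqrt (sqn f).
Proof.
elim: n g f => [|n IH] g f ff fg.
  rewrite /= word_prod_nil invg1 expR0 mul1r /coset_walks /=.
  (* If [f] does not vanish at 1, the support condition puts 1 in [Hg]; then [Hg] is [H] and the
     coset count is 1. *)
  have [f1|f1] := eqVneq (f 1%g) 0; first by rewrite f1 mulr_ge0 ?ler0n ?sqrtr_ge0.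
  have /rtranslateE := fg _ f1; rewrite mul1g => /(subgroupV _ _ H_subgroup).
  rewrite invgK => Hg; rewrite rtranslate_subgroup// eqxx mul1r.
  apply: le_trans (ler_norm _) _; rewrite -sqrtr_sqr ler_wsqrtr//.
  exact: sqr_le_sqn.
(* As [(s w)^-1 = w^-1 s^-1], the first letter is absorbed into [f] as a right translation. *)
pose fs s x := f (x * s^-1)%g.
have ffs s : finitely_supported (fs s) by exact: finitely_supported_translate.
have step s w : expR (loop_gain g (s :: w)) * f (word_prod (s :: w))^-1%g =
    expR (if s \in loops g then loop_rate g else 0) *
    (expR (loop_gain (g * s)%g w) * fs s (word_prod w)^-1%g).
  by rewrite word_prod_cons invgM /= expRD mulrA.
rewrite coset_walksS /= (eq_bigr (fun s => expR (if s \in loops g then loop_rate g else 0) *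
    word_sum S n (fun w => expR (loop_gain (g * s)%g w) *
      fs s (word_prod w)^-1%g))); last first.
  by move=> s _; rewrite -word_sumZ; apply: eq_word_sum => w; rewrite step.
rewrite mulr_suml.
rewrite (big_fsetID _ (mem (conj_set H g))) [leRHS](big_fsetID _ (mem (conj_set H g)))/=.
rewrite -[[fset x in S | x \in conj_set H g]%fset]/(loops g).
apply: lerD; last first.
  (* A non-loop letter carries weight 1: induction applies to the translate of [f], of the same
     norm, at the vertex [g * s]. *)
  rewrite big_seq [leRHS]big_seq; apply: ler_sum => s sSg.
  have /andP[sS /negbTE sg] : (s \in S) && (s \notin conj_set H g).
    by move: sSg; rewrite !inE.
  have -> : (s \in loops g) = false by rewrite !inE /= sg andbF.
  rewrite expR0 mul1r rtranslateM -(sqn_translate f s^-1%g).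
  apply: IH => // x /fg /rtranslateE Hx; apply/rtranslateE.
  by rewrite invgM mulgA.
(* All loop letters together are absorbed into one function, still supported in [Hg], and induction
   applies at the same vertex. *)
pose fl x := expR (loop_rate g) * conv (loops g) f x.
have ffl : finitely_supported fl.
  exact/finitely_supportedZ/finitely_supported_conv.
have -> : \sum_(s <- loops g)
      expR (if s \in loops g then loop_rate g else 0) *
      word_sum S n (fun w => expR (loop_gain (g * s)%g w) * fs s (word_prod w)^-1%g)
    = word_sum S n (fun w => expR (loop_gain g w) * fl (word_prod w)^-1%g).
  under [RHS]eq_word_sum => w.
    rewrite /fl /conv /act_sum.
    rewrite -(big_symmetric _ (fun s => f ((word_prod w)^-1 * s)%g) (loops_sym g)).
    rewrite mulrCA mulr_sumr mulr_sumr.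
    over.
  rewrite word_sum_sum big_seq [RHS]big_seq; apply: eq_bigr => s sg.
  rewrite sg -word_sumZ; apply: eq_word_sum => w.
  by rewrite loop_gain_loop.
have fl_g x : fl x != 0 -> rtranslate H g x.
  rewrite mulf_eq0 negb_or => /andP[_] fx.
  have [//|Hx] := pselect (rtranslate H g x).
  case/negP: fx; rewrite /conv /act_sum big_seq big1// => s sg.
  apply/eqP; apply: contra_notT Hx => /fg /rtranslateE Hxs.
  apply/rtranslateE; have [_ Hs] := loopsP _ _ sg.
  rewrite -(subgroupMr _ (x * g^-1)%g ((g * s * g^-1)%g))//.
  by rewrite !mulgA mulgVK.
apply: le_trans (IH _ _ ffl fl_g) _.
have -> : \sum_(s <- loops g) coset_walks n (rtranslate (rtranslate H g) s) *
    Num.sqrt (sqn f) =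
    coset_walks n (rtranslate H g) * (#|` loops g|%:R * Num.sqrt (sqn f)).
  rewrite big_seq (eq_bigr (fun=> coset_walks n (rtranslate H g) * Num.sqrt (sqn f))).
    by rewrite -big_seq big_const_seq count_predT iter_addr_0 mulr_natl mulrnAr.
  move=> s /loopsP[_ Hs]; rewrite rtranslateM.
  by rewrite -(rtranslate_lmul (g * s * g^-1)%g g)// mulgVK.
apply: ler_wpM2l; first exact: coset_walks_ge0.
rewrite -[X in X * _]ger0_norm// -sqrtr_sqr -sqrtrM ?sqr_ge0// ler_wsqrtr//.
rewrite sqnZ -expR_loop_rate exprMn -[leRHS]mulrA; apply: ler_wpM2l; first exact: sqr_ge0.
by apply: sqn_conv_le_rho => //; [exact: gen_loops|exact: gen1|exact: loops_sym].
Qed.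

End Loops.

(** * The occupation measure of closed walks *)

Section Occupation.
Context {R : realType} {G : groupType}.
Variable S : {fset G}.

Lemma tuple_word_sum n (P : seq G -> R) :
  \sum_(w : n.-tuple S) P [seq fsval a | a <- w] = word_sum S n P.
Proof.
elim: n P => [|n IH] P.
  by rewrite (big_pred1 [tuple])//= => w; apply/esym/eqP; exact: tuple0.
rewrite /= big_seq_fsetE/=.
rewrite (reindex (fun p : S * n.-tuple S => cons_tuple p.1 p.2))/=; last first.
  exists (fun w : n.+1.-tuple S => (thead w, behead_tuple w)).
    by move=> [a w] _ /=; congr pair; exact: val_inj.
  by move=> w _ /=; rewrite [RHS]tuple_eta; apply/val_inj.
rewrite -(pair_big xpredT xpredT
  (fun (a : S) (w : n.-tuple S) => P (fsval a :: [seq fsval a | a <- w])))/=.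
by apply: eq_bigr => a _; rewrite -IH.
Qed.

Lemma walk_posE n (w : n.-tuple S) i :
  walk_pos w i = word_prod (take i [seq fsval a | a <- w]).
Proof. by rewrite /walk_pos /word_prod -map_take big_map. Qed.

Lemma sum_closed_walk n (P : seq G -> R) :
  \sum_(w : n.-tuple S | closed_walk w) P [seq fsval a | a <- w] =
  word_sum S n (fun w => P w * delta1 (word_prod w)).
Proof.
rewrite -tuple_word_sum big_mkcond/=; apply: eq_bigr => w _.
rewrite /closed_walk /= walk_posE take_oversize ?size_map ?size_tuple// /delta1.
by case: eqP => _; rewrite ?mulr1 ?mulr0.
Qed.

Lemma card_closed_walk n :
  #|@closed_walk G S n|%:R = iter n (conv S) delta1 1%g :> R.
Proof.
rewrite -sum1_card natr_sum iter_convE (sum_closed_walk n (fun=> 1)).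
by apply: eq_word_sum => w; rewrite mul1r mul1g.
Qed.

Lemma integral_mu n (h : G -> R) : (forall g, 0 <= h g) ->
  (\int[mu R S n]_(g in [set: discrete_group G]) (h g)%:E =
   (#|@closed_walk G S n|%:R^-1 * (n%:R^-1 * word_sum S n (fun w =>
     (\sum_(1 <= i < n.+1) h (word_prod (take i w))) * delta1 (word_prod w))))%:E)%E.
Proof.
move=> h0.
(* Listing the positions of all closed walks with multiplicity makes [mu] a scaled sum of Dirac
   masses. *)
pose r := [seq (walk_pos w i : discrete_group G) |
  w <- enum (@closed_walk G S n), i <- index_iota 1 n.+1].
have c0 : 0 <= #|@closed_walk G S n|%:R^-1 * n%:R^-1 :> R.
  by rewrite mulr_ge0 ?invr_ge0.
pose ds k : {measure set (discrete_group G) -> \bar R} :=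
  dirac (nth (1%g : discrete_group G) r k).
rewrite (eq_measure_integral (mscale (NngNum c0) (msum ds (size r)))); last first.
  move=> B _ _.
  have E : (\sum_(x <- r) \d_x B = \sum_(k < size r) ds k B :> \bar R)%E.
    by rewrite (big_nth (1%g : discrete_group G)) big_mkord.
  transitivity ((#|@closed_walk G S n|%:R^-1 * n%:R^-1)%:E *
    \sum_(x <- r) (\d_x B : \bar R))%E; last by rewrite E.
  rewrite big_allpairs_dep/= EFinM -muleA big_enum/=.
  rewrite ge0_sume_distrr//; last by move=> w _; exact: sume_ge0.
rewrite ge0_integral_mscale//; last by move=> x _; rewrite lee_fin.
rewrite ge0_integral_measure_sum//; last by move=> x _; rewrite lee_fin.
rewrite (eq_bigr (fun k : 'I_(size r) => (h (nth (1%g : G) r k))%:E)); last first.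
  by move=> k _; rewrite integral_dirac// diracT mul1e.
have <- : (\sum_(x <- r) (h x)%:E =
    \sum_(k < size r) (h (nth (1%g : G) r k))%:E)%E.
  by rewrite (big_nth (1%g : discrete_group G)) big_mkord.
rewrite sumEFin -EFinM /= -mulrA; congr ((_ * (_ * _))%:E).
rewrite big_allpairs_dep/= -sum_closed_walk big_enum/=.
by apply: eq_bigr => w _; apply: eq_bigr => i _; rewrite walk_posE.
Qed.

End Occupation.

(** * Growth of closed walks *)

Section LoopInsertion.
Context {R : realType} {G : groupType}.
Variables (S : {fset G}) (H : set G).
Hypothesis S_sym : symmetric_fset S.
Hypothesis H_subgroup : subgroup H.
Implicit Types (g s x : G) (w : seq G) (n m : nat).

Lemma integrand_sumE g w : @integrand_sum R G S H g w =
  \sum_(0 <= i < (size w).+1) integrand R H S (g * word_prod (take i w))%g.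
Proof.
elim: w g => [|s w IH] g /=.
  by rewrite big_nat1 word_prod_nil mulg1 addr0.
rewrite big_nat_recl// take0 word_prod_nil mulg1 IH; congr (_ + _).
by apply: eq_bigr => i _; rewrite /= word_prod_cons mulgA.
Qed.

Lemma loop_gain_sumS m g :
  word_sum S m.+1 (fun w => loop_gain S H g w * delta1 (g * word_prod w)%g) =
  \sum_(s <- S) (if s \in loops S H g then @loop_rate R G S H g else 0) *
    iter m (conv S) delta1 (g * s)%g +
  \sum_(s <- S) word_sum S m (fun w =>
    loop_gain S H (g * s)%g w * delta1 (g * s * word_prod w)%g).
Proof.
rewrite /= -big_split; apply: eq_bigr => s _ /=.
rewrite iter_convE -word_sumZ -word_sumD; apply: eq_word_sum => w.
by rewrite word_prod_cons mulgA mulrDl.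
Qed.

Lemma integrand_sumS m g :
  word_sum S m.+1 (fun w => integrand_sum S H g w * delta1 (g * word_prod w)%g) =
  integrand R H S g * iter m.+1 (conv S) delta1 g +
  \sum_(s <- S) word_sum S m (fun w =>
    integrand_sum S H (g * s)%g w * delta1 (g * s * word_prod w)%g).
Proof.
rewrite iter_convE/= mulr_sumr -big_split; apply: eq_bigr => s _ /=.
rewrite -word_sumZ -word_sumD; apply: eq_word_sum => w.
by rewrite word_prod_cons mulgA mulrDl.
Qed.

(** Each loop [s] followed by [s^-1] can precede a word from [g] to 1; summing over the loops
    produces the cardinal factor of the integrand. *)
Lemma loop_step_ge m g :
  integrand R H S g * iter m (conv S) delta1 g <=
  \sum_(s <- S) (if s \in loops S H g then loop_rate S H g else 0) *
    iter m.+1 (conv S) delta1 (g * s)%g.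
Proof.
have sub : (loops S H g `<=` S)%fset by apply/fsubsetP => s /loopsP[].
rewrite -(big_fset_incl _ sub); last by move=> s _ /negbTE ->; rewrite mul0r.
apply: (@le_trans _ _ (\sum_(s <- loops S H g)
    loop_rate S H g * iter m (conv S) delta1 g)).
  by rewrite big_const_seq count_predT iter_addr_0 integrandE -mulrA mulr_natl.
rewrite big_seq [leRHS]big_seq; apply: ler_sum => s sg; rewrite sg.
apply: ler_wpM2l; first exact: loop_rate_ge0.
by apply: return2_ge => //; have [] := loopsP _ _ _ _ sg.
Qed.

(* A closed walk becomes two steps longer by inserting [s, s^-1] for a loop [s]. *)
Lemma loop_insertion m g :
  word_sum S m (fun w => integrand_sum S H g w * delta1 (g * word_prod w)%g) <=
  @word_sum R G S m.+2 (fun w => loop_gain S H g w * delta1 (g * word_prod w)%g).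
Proof.
elim: m g => [|m IH] g; rewrite loop_gain_sumS.
  apply: ler_wpDr; last first.
    apply: le_trans (loop_step_ge 0 g).
    by rewrite /= addr0 word_prod_nil mulg1.
  apply: sumr_ge0 => s _; apply: word_sum_ge0 => w.
  by rewrite mulr_ge0 ?ler0n// loop_gain_ge0.
(* The term at the starting position is paid for by a loop as first letter, those at later positions
   by induction. *)
rewrite integrand_sumS; apply: lerD; first exact: loop_step_ge.
by apply: ler_sum => s _; exact: IH.
Qed.

Lemma return_gt0 s n : s \in S -> 0 < iter n.*2 (conv S) (@delta1 R G) 1%g.
Proof.
move=> sS; elim: n => [|n IH]; first by rewrite /= /delta1 eqxx ltr01.
apply: lt_le_trans IH _; rewrite doubleS.
apply: le_trans (return2_ge S _ _ _ S_sym sS) _.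
apply: le_trans (return2_ge S _ _ _ S_sym (S_sym _ sS)) _.
by rewrite mulgK.
Qed.

Lemma sqn_iter_gt0 s n : s \in S -> 0 < sqn (iter n (conv S) (@delta1 R G)).
Proof. by move=> sS; rewrite sqn_iter_conv_delta1// addnn (return_gt0 s). Qed.

(** If no ratio of successive [P k] exceeded [lam], then [P k <= lam ^+ k] would force the squared
    norm of the convolution below [lam]. Once one ratio exceeds [lam], log-convexity keeps all later
    ones above it. *)
Lemma return_growth (lam : R) : S != fset0 -> 0 < lam ->
  lam < (#|` S|%:R * rho_cayley R [set: G] S) ^+ 2 ->
  exists2 c, 0 < c & exists j0, forall j, (j0 <= j)%N ->
    c * lam ^+ j <= sqn (iter j (conv S) delta1).
Proof.
move=> S0 lam0 lamK; pose P k := sqn (iter k (conv S) (@delta1 R G)).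
have P0 k : 0 <= P k by exact: sqn_ge0.
have logP k : P k.+1 ^+ 2 <= P k * P k.+2.
  exact/(sqn_iter_conv_logconvex S S_sym)/finitely_supported_delta1.
have [k Pk] : exists k, lam * P k < P k.+1.
  apply: contrapT => /forallNP nP; move: lamK; apply/negP; rewrite -leNgt.
  apply: rho_cayley_le_of_sqn => //; first exact: ltW.
  apply: sqn_conv_le_of_return => //; first exact: ltW.
  elim=> [|k IH]; first by rewrite expr0 /= sqn_delta1.
  have /negP := nP k; rewrite -leNgt => /le_trans; apply.
  by rewrite exprS ler_wpM2l// ltW.
have Pkp : 0 < P k.
  rewrite lt_neqAle P0 andbT eq_sym; apply/eqP => z.
  move: Pk (logP k); rewrite z mulr0 mul0r => Pk.
  by rewrite leNgt exprn_gt0.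
have grow j : lam * P (k + j)%N <= P (k + j.+1)%N.
  rewrite -(ler_pM2l Pkp).
  have logPk i : P (k + i.+1)%N ^+ 2 <= P (k + i)%N * P (k + i.+2)%N.
    by rewrite !addnS; exact: logP.
  have H1 := @logconvex_ratio _ (fun i => P (k + i)%N) (fun=> P0 _) logPk j.
  rewrite addn0 addn1 in H1; apply: le_trans H1.
  by rewrite mulrA [P k * lam]mulrC; apply: ler_wpM2r => //; exact: ltW.
exists (P k / lam ^+ k); first by rewrite divr_gt0 ?exprn_gt0.
exists k => j kj; rewrite -[j](subnKC kj).
elim: (j - k)%N => [|i IH]; first by rewrite addn0 divfK// gt_eqF ?exprn_gt0.
apply: le_trans (grow i); rewrite addnS exprS mulrCA.
by apply: ler_wpM2l => //; exact: ltW.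
Qed.

Lemma right_cosets_stable s (C : set G) : s \in S -> right_cosets H C ->
  right_cosets H (rtranslate C s).
Proof.
by move=> _ [g _ <-]; exists (g * s)%g => //; rewrite rtranslateM.
Qed.

Lemma rtranslate_inj s (C D : set G) : rtranslate C s = rtranslate D s -> C = D.
Proof.
move=> /(congr1 (rtranslate^~ s^-1%g)).
by rewrite !rtranslateM mulgV !rtranslate1.
Qed.

Lemma rho_schreier_ge0 : 0 <= rho_schreier R H S.
Proof.
apply: act_avg_opnorm_ge0; first exact: right_cosets_stable.
by move=> s C D _ _ _; exact: rtranslate_inj.
Qed.

Lemma coset_walks_le n :
  @coset_walks R G S H n H <= (#|` S|%:R * rho_schreier R H S) ^+ n.
Proof.
apply: iter_act_sum_le; first exact: right_cosets_stable.
  by move=> s C D _ _ _; exact: rtranslate_inj.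
by exists 1%g => //; exact: rtranslate1.
Qed.

Lemma weighted_return_le n :
  word_sum S n (fun w => expR (loop_gain S H 1%g w) * @delta1 R G (word_prod w)) <=
  (#|` S|%:R * rho_schreier R H S) ^+ n.
Proof.
apply: le_trans (coset_walks_le n).
have := @weighted_walks_le R G S H S_sym H_subgroup n 1%g delta1.
rewrite sqn_delta1 sqrtr1 mulr1 rtranslate1.
under eq_word_sum do rewrite /delta1 invg_eq1.
apply; first exact: finitely_supported_delta1.
move=> x; rewrite /delta1; have [-> _|_] := eqVneq x 1%g; last by rewrite eqxx.
exact: subgroup1.
Qed.

(** The real number that [integral_mu] assigns to the integral of the integrand against [mu]. *)
Definition mean_integrand n : R :=
  (#|@closed_walk G S n|%:R^-1 * (n%:R^-1 * word_sum S n (fun w =>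
   (\sum_(1 <= i < n.+1) integrand R H S (word_prod (take i w))) *
     delta1 (word_prod w)))).

Lemma closed_walks_expR_mean_le s n : s \in S -> (0 < n)%N ->
  sqn (iter n.+1 (conv S) delta1) *
    expR (n.*2%:R * mean_integrand n.*2 /
      (#|` S|%:R * rho_cayley R [set: G] S) ^+ 2) <=
  (#|` S|%:R * rho_schreier R H S) ^+ n.+1.*2.
Proof.
move=> sS n0; apply: le_trans (weighted_return_le n.+1.*2).
set K := (_ * rho_cayley _ _ _) ^+ 2.
have c1 := return_gt0 s n sS; have c2 := return_gt0 s n.+1 sS.
set c := iter n.*2 _ _ _ in c1; set c' := iter n.+1.*2 _ _ _ in c2.
(* Both counts are squared norms of consecutive iterates, so one application of the norm bound
   compares them. *)
have cK : c' <= K * c.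
  rewrite /c /c' -!addnn -!sqn_iter_conv_delta1// iterS.
  apply: sqn_conv_le_rho => //.
  exact/finitely_supported_iter_conv/finitely_supported_delta1.
have K0 : 0 < K by have := lt_le_trans c2 cK; rewrite pmulr_lgt0.
have c'E : word_sum S n.+1.*2 (fun w => @delta1 R G (word_prod w)) = c'.
  by rewrite /c' iter_convE; apply: eq_word_sum => w; rewrite mul1g.
have := @word_sum_expR_ge R G S n.+1.*2 (fun w => delta1 (word_prod w))
  (loop_gain S H 1%g) (fun w => ler0n _ _).
rewrite c'E => /(_ c2); apply: le_trans.
rewrite sqn_iter_conv_delta1// addnn -/c' ler_pM2l// ler_expR.
rewrite ler_pdivlMr// mulrAC.
have n0' : n.*2%:R != 0 :> R by rewrite pnatr_eq0 double_eq0 -lt0n.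
have E : n.*2%:R * mean_integrand n.*2 * c = word_sum S n.*2 (fun w =>
   (\sum_(1 <= i < n.*2.+1) integrand R H S (word_prod (take i w))) *
     delta1 (word_prod w)).
  rewrite /mean_integrand card_closed_walk -/c.
  set W := word_sum _ _ _; field; rewrite n0' gt_eqF//.
have W0 : 0 <= n.*2%:R * mean_integrand n.*2.
  rewrite -(pmulr_lge0 _ c1) E; apply: word_sum_ge0 => w.
  by rewrite mulr_ge0 ?ler0n// sumr_ge0// => i _; exact: integrand_ge0.
apply: (@le_trans _ _ (n.*2%:R * mean_integrand n.*2 * c)).
  rewrite ler_pdivrMr// -[leRHS]mulrA [c * K]mulrC.
  exact: ler_wpM2l.
rewrite E.
have := loop_insertion n.*2 1%g.
under [X in _ <= X -> _]eq_word_sum do rewrite mul1g.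
rewrite -doubleS; apply: le_trans.
apply: ler_word_sum => w wn; rewrite mul1g ler_wpM2r ?ler0n//.
(* The occupation sum starts at position 1; the nonnegative term at position 0 is dropped. *)
rewrite integrand_sumE wn [leRHS]big_nat_recl//.
rewrite [X in X <= _]big_add1 /=.
apply: ler_wpDl; first exact: integrand_ge0.
by under [X in _ <= X]eq_bigr do rewrite mul1g.
Qed.

End LoopInsertion.

(** * Passage to the limit *)

Lemma limn_esup_le {R : realType} (u : nat -> \bar R) (b : \bar R) N :
  (forall n, (N <= n)%N -> (u n <= b)%E) -> (limn_esup u <= b)%E.
Proof.
move=> ub; rewrite /limn_esup limf_esupE; apply: le_trans (ereal_inf_lbound _) _.
  by exists [set n | (N <= n)%N] => //; exists N.
by apply: ge_ereal_sup => _ [n /= Nn <-]; exact: ub.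
Qed.

(** Logarithms of the last hypothesis give [2n J / K <= (n + 1) (2D + e) - ln c]; the lower bound on
    [n] says exactly that the right side is at most [2n (D + e)]. *)
Lemma le_of_exponential_growth {R : realType} (K lam r c J D e : R) (n : nat) :
  (0 < n)%N -> 0 < K -> 0 < r -> 0 < c -> 0 < e ->
  D = ln r - ln K / 2 -> lam = K * expR (- e) ->
  (e + 2 * D - ln c) / e <= n%:R ->
  c * lam ^+ n.+1 * expR (n.*2%:R * J / K) <= (r ^+ 2) ^+ n.+1 ->
  J <= K * (D + e).
Proof.
move=> n0 K0 r0 c0 e0 DE lamE ne.
have lam0 : 0 < lam by rewrite lamE mulr_gt0 ?expR_gt0.
have cl0 : 0 < c * lam ^+ n.+1 by rewrite mulr_gt0 ?exprn_gt0.
have r2 : 0 < r ^+ 2 by rewrite exprn_gt0.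
rewrite -ler_ln ?posrE; first last.
- exact: exprn_gt0.
- by apply: mulr_gt0 => //; exact: expR_gt0.
rewrite !lnM ?posrE ?exprn_gt0 ?expR_gt0//.
rewrite (lnXn n.+1 lam0) (lnXn n.+1 r2) (lnXn 2 r0) expRK.
have mulSn (x : R) : x *+ n.+1 = x * (n%:R + 1)
  by rewrite mulrSr mulrDr mulr1 mulr_natr.
rewrite lamE lnM ?posrE ?expR_gt0// expRK !mulSn mulr2n.
rewrite -mulrA -addnn natrD => H.
rewrite mulrC -ler_pdivrMr//; set q := J / K in H *.
move: ne; rewrite ler_pdivrMr// => ne.
have np : 0 < n%:R :> R by rewrite ltr0n.
suff : n%:R * q <= n%:R * (D + e) by rewrite ler_pM2l.
by rewrite DE in ne *; lra.
Qed.

Theorem theorem2p1 (R : realType) (G : groupType) (S : {fset G}) (H : set G)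
    (S_sym : forall s : G, s \in S -> (s^-1)%g \in S)
    (S_gen : gen [set` S] = [set: G])
    (H_subgroup : subgroup H) :
  ((ln (rho_schreier R H S) - ln (rho_cayley R [set: G] S))%:E >=
   I_limsup R H S / (#|` S|%:R ^+ 2 * rho_cayley R [set: G] S ^+ 2)%:E)%E.
Proof.
have intE n : (\int[mu R S n]_(g in [set: discrete_group G])
    (integrand R H S g)%:E = (@mean_integrand R G S H n)%:E)%E.
  by apply: integral_mu => g; exact: integrand_ge0.
(* For empty [S] the averages vanish because [0^-1 = 0]; both radii and the limsup are then 0. *)
have [S0|/fset0Pn[s sS]] := eqVneq S fset0.
  have rho0 (T : choiceType) (act : T -> G -> T) X :
      (forall s x, s \in S -> X x -> X (act x s)) ->
      opnorm X (@act_avg R T G act S) = 0.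
    move=> stable; have inj s x y : s \in S -> X x -> X y ->
      act x s = act y s -> x = y by rewrite S0.
    apply/eqP; rewrite eq_le act_avg_opnorm_ge0// andbT.
    apply: act_avg_opnorm_le => // f _ A _; rewrite expr0n big1// => x _.
    by rewrite /act_avg S0 cardfs0 invr0 mul0r expr0n.
  have -> : rho_schreier R H S = 0 by apply: rho0 => s x; rewrite S0.
  have -> : rho_cayley R [set: G] S = 0 by apply: rho0.
  rewrite subrr (_ : I_limsup R H S = 0%E) ?mul0e//.
  rewrite /I_limsup (_ : (fun n => _) = fun=> 0%E).
    exact: (cvg_limn_einf_sup (cvg_cst _)).2.
  apply/funext => n; rewrite intE /mean_integrand.
  rewrite (_ : word_sum _ _ _ = 0) ?mulr0//.
  case: n => [|n]; last by rewrite /= S0 big_seq_fset0.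
  by rewrite /= big_geq// mul0r.
have S0 : S != fset0 by apply/fset0Pn; exists s.
have cS : 0 < #|` S|%:R :> R by rewrite ltr0n cardfs_gt0.
rewrite -exprMn; set K := (_ ^+ 2).
set D := ln _ - ln _.
have key n : (0 < n)%N -> _ := @closed_walks_expR_mean_le R G S H S_sym H_subgroup s n sS.
(* Both radii must be positive for [ln] to turn products into sums, since [ln 0 = 0] by
   convention. *)
have rho0 : 0 < rho_cayley R [set: G] S.
  rewrite lt_neqAle rho_cayley_ge0// andbT eq_sym; apply/eqP => z.
  have := @sqn_conv_le_rho R G [set: G] S delta1 (fun _ _ _ _ => I) I S_sym
    finitely_supported_delta1.
  rewrite z mulr0 expr0n mul0r leNgt.
  by rewrite (sqn_iter_gt0 S S_sym s 1 sS).
have K0 : 0 < K by rewrite exprn_gt0// mulr_gt0.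
have rhoH : 0 < rho_schreier R H S.
  rewrite lt_neqAle rho_schreier_ge0 andbT eq_sym; apply/eqP => z.
  have := key 1%N isT; rewrite z mulr0 expr0n /= leNgt.
  by rewrite mulr_gt0 ?expR_gt0// (sqn_iter_gt0 S S_sym s 2 sS).
have DE : D = ln (#|` S|%:R * rho_schreier R H S) - ln K / 2.
  by rewrite /D /K lnXn ?mulr_gt0// mulr2n !lnM ?posrE//; lra.
rewrite inver gt_eqF//.
apply/lee_addgt0Pr => e e0; rewrite -EFinD.
(* A rate strictly below [K] is eventually reached by the closed words; the loss [e] is the slack
   just introduced. *)
have lamK : K * expR (- e) < K by rewrite gtr_pMr// expR_lt1 oppr_lt0.
have lam0 : 0 < K * expR (- e) by rewrite mulr_gt0 ?expR_gt0.
have [c c0 [j0 growth]] := @return_growth R G S S_sym _ S0 lam0 lamK.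
(* Beyond [N] the length is positive, the growth bound holds, and the threshold of
   [le_of_exponential_growth] is passed. *)
pose N := maxn (maxn 1 j0) (Num.bound `|(e + 2 * D - ln c) / e|).
apply: (@le_trans _ _ ((K * (D + e))%:E * (K^-1)%:E)%E); last first.
  by rewrite -EFinM lee_fin mulrC mulKf// gt_eqF.
apply: lee_wpmul2r; first by rewrite lee_fin invr_ge0 ltW.
apply: (@limn_esup_le _ _ _ N) => n; rewrite !geq_max -andbA => /and3P[n0 nj nb].
rewrite intE lee_fin.
apply: (@le_of_exponential_growth _ K _ (#|` S|%:R * rho_schreier R H S) c _ D e n) => //.
- by rewrite mulr_gt0.
- apply: le_trans (ler_norm _) _; apply: le_trans (ltW (archi_boundP (normr_ge0 _))) _.
  by rewrite ler_nat.
- rewrite -exprM mul2n; apply: le_trans (key n n0); apply: ler_wpM2r; first exact: expR_ge0.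
  by apply: growth; exact: leqW.
Qed.
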